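(* Let $\mathbb{X}$ be a finite-dimensional normed space, let $f:\mathbb{X}\rightarrow\mathbb{R}\cup\{+\infty\}$ be a proper lower semicontinuous function, let $\mathbf{S}_f:=\{x\in\mathbb{X}: f(x)\leq 0\}$ and let $\bar x\in\mathbf{S}_f$. Suppose that the inequality $f(x)\leq 0$ has a local error bound at $\bar x$ and that $f$ is continuous at $\bar x$. Then there exists $\tau>0$ such that $$N(\mathbf{S}_f,\bar x)\cap\mathbb{B}_{\mathbb{X}^*}\subseteq[0,\tau]\,\partial f(\bar x)+\partial^{\infty}f(\bar x).$$
   Context: $\mathbb{X}^*$ is the dual space, $\mathbb{B}_{\mathbb{X}^*}$ its closed unit ball, $\mathbb{B}(x,r)$ is the open ball with center $x$ and radius $r$, and $\mathbf{d}(x,\Omega):=\inf\{\|x-u\|:u\in\Omega\}$. Local error bound: the inequality $f(x)\leq 0$ has a local error bound at $\bar x\in\mathbf{S}_f$ if there exist $\tau,\delta\in(0,+\infty)$ such that $\mathbf{d}(x,\mathbf{S}_f)\leq\tau f_+(x)$ for all $x\in\mathbb{B}(\bar x,\delta)$, where $f_+(x):=\max\{f(x),0\}$. Normal cones: for a subset $A$ of a Banach space $\mathbb{X}$, $a\in A$ and $\varepsilon\geq 0$, let $\hat N_\varepsilon(A,a):=\{x^*\in\mathbb{X}^*:\limsup_{x\to a,\,x\in A}\frac{\langle x^*,x-a\rangle}{\|x-a\|}\leq\varepsilon\}$ and $\hat N(A,a):=\hat N_0(A,a)$ (Fréchet normal cone). The Mordukhovich (limiting) normal cone $N(A,a)$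 is the set of $x^*\in\mathbb{X}^*$ for which there exist sequences $\varepsilon_n\downarrow 0$, $x_n\to a$ with $x_n\in A$, and $x_n^*\to x^*$ in the weak$^*$ topology with $x_n^*\in\hat N_{\varepsilon_n}(A,x_n)$ for all $n$ (in an Asplund space, in particular in finite dimensions, and for closed $A$ one may equivalently take $\varepsilon_n=0$). Subdifferentials: with $\mathrm{epi}\,f:=\{(x,r)\in\mathbb{X}\times\mathbb{R}: f(x)\leq r\}$ and $x$ with $f(x)<+\infty$, the Mordukhovich subdifferential is $\partial f(x):=\{x^*\in\mathbb{X}^*:(x^*,-1)\in N(\mathrm{epi}\,f,(x,f(x)))\}$ and the Mordukhovich singular subdifferential is $\partial^{\infty}f(x):=\{x^*\in\mathbb{X}^*:(x^*,0)\in N(\mathrm{epi}\,f,(x,f(x)))\}$.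
   Formalization: The set [0,τ]∂f(x̄) is read with the convention 0·∂f(x̄)={0} even when ∂f(x̄) is empty; otherwise the inclusion fails, e.g. for f(x)=x^{1/3} at 0, where ∂f(0) is empty; nothing changes when ∂f(x̄) is nonempty. *)

(* Defs.v *)
From mathcomp Require Import all_boot all_order all_algebra.
From mathcomp Require Import all_classical all_reals all_analysis.

Set Implicit Arguments.
Unset Strict Implicit.
Unset Printing Implicit Defensive.

Import Order.TTheory GRing.Theory Num.Theory.
Import numFieldNormedType.Exports.

Local Open Scope classical_set_scope.
Local Open Scope ring_scope.

Definition finite_dimensional (R : realType) (X : normedModType R) : Prop :=
  exists (n : nat) (e : 'I_n -> X),
    forall x : X, exists c : 'I_n -> R, x = \sum_(i < n) c i *: e i.

(* Elements of the dual are represented by their underlying functions. *)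
Definition dual (R : realType) (X : normedModType R) : set (X -> R) :=
  [set g : X -> R | linear (g : X -> R^o) /\ continuous g].

Definition dual_norm (R : realType) (X : normedModType R) (g : X -> R) : \bar R :=
  ereal_sup [set (`|g x|)%:E | x in [set x : X | `|x| <= 1]].

Definition dual_unit_ball (R : realType) (X : normedModType R) : set (X -> R) :=
  [set g | dual g /\ (dual_norm g <= 1)%E].

Definition distance (R : realType) (X : normedModType R) (x : X) (A : set X) :
    \bar R :=
  ereal_inf [set (`|x - u|)%:E | u in A].

(* If a is isolated in A the filter is improper and the limsup is -oo, so every
   continuous functional is normal. *)
Definition eps_normals (R : realType) (X : normedModType R)
    (eps : R) (A : set X) (a : X) : set (X -> R) :=
  [set g | dual g /\
    (limf_esup (fun x => (g (x - a) / `|x - a|)%:E) (within A a^') <= eps%:E)%E].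

(* Weak* convergence of a sequence of functionals is pointwise convergence. *)
Definition limiting_normals (R : realType) (X : normedModType R)
    (A : set X) (a : X) : set (X -> R) :=
  [set g | dual g /\
    exists (eps : R^nat) (x : nat -> X) (h : nat -> X -> R),
      [/\ (forall n, 0 <= eps n) /\ nonincreasing_seq eps,
          eps n @[n --> \oo] --> 0,
          (forall n, A (x n)) /\ x n @[n --> \oo] --> a,
          (forall n, eps_normals (eps n) A (x n) (h n)) &
          forall v : X, h n v @[n --> \oo] --> g v]].

Definition epigraph (R : realType) (X : normedModType R) (f : X -> \bar R) :
    set (X * R) :=
  [set p | (f p.1 <= p.2%:E)%E].

(* The functional (g, c) in the dual of X * R.  The library norm on X * R is the
   max norm; limiting normal cones are the same for all equivalent norms. *)
Definition dual_pair (R : realType) (X : normedModType R) (g : X -> R) (c : R) :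
    X * R -> R :=
  fun p => g p.1 + c * p.2.

(* The next two sets are only meant for x with f x finite, since they involve
   fine (f x). *)
Definition subdifferential (R : realType) (X : normedModType R)
    (f : X -> \bar R) (x : X) : set (X -> R) :=
  [set g | dual g /\
    limiting_normals (epigraph f) (x, fine (f x)) (dual_pair g (-1))].

Definition singular_subdifferential (R : realType) (X : normedModType R)
    (f : X -> \bar R) (x : X) : set (X -> R) :=
  [set g | dual g /\
    limiting_normals (epigraph f) (x, fine (f x)) (dual_pair g 0)].

Definition sublevel0 (R : realType) (X : normedModType R) (f : X -> \bar R) :
    set X :=
  [set x | (f x <= 0)%E].

Definition local_error_bound (R : realType) (X : normedModType R)
    (f : X -> \bar R) (xbar : X) : Prop :=
  exists tau delta : R, [/\ 0 < tau, 0 < delta &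
    forall x, ball xbar delta x ->
      (distance x (sublevel0 f) <= tau%:E * maxe (f x) 0)%E].

(* The set [0, tau] A with the convention 0 A = {0}, which matters only for
   empty A.  With [0, tau] set0 = set0 instead, the inclusion
     N(S_f, xbar) `&` B <= [0, tau] (subdifferential f xbar)
                           + singular_subdifferential f xbar
   fails for the cube root on the real line at 0: the error bound holds, the
   subdifferential at 0 is empty, and both the normal cone to S_f and the
   singular subdifferential are the nonnegative reals. *)
Definition scaled_upto (R : realType) (X : normedModType R)
    (tau : R) (A : set (X -> R)) : set (X -> R) :=
  [set g | g = cst 0 \/
    exists t h, [/\ 0 <= t <= tau, A h & g = (fun x => t * h x)]].

Lemma scaled_upto_nonempty (R : realType) (X : normedModType R)
    (tau : R) (A : set (X -> R)) :
  0 <= tau -> A !=set0 ->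
  scaled_upto tau A =
    [set g | exists t h, [/\ 0 <= t <= tau, A h & g = (fun x => t * h x)]].
Proof.
move=> tau0 [h0 Ah0]; apply/seteqP; split=> g /=; last by right.
case=> // ->; exists 0, h0; split=> //; first by rewrite lexx.
by apply/funext => x; rewrite mul0r.
Qed.

Definition minkowski_sum (R : realType) (X : normedModType R)
    (A B : set (X -> R)) : set (X -> R) :=
  [set g | exists a b, [/\ A a, B b & g = a \+ b]].

(* Main.v *)
Require Import Defs.
From mathcomp Require Import all_boot all_order all_algebra.
From mathcomp Require Import all_classical all_reals all_analysis.
From mathcomp Require Import ring lra.

Import Order.TTheory GRing.Theory Num.Theory.
Import numFieldNormedType.Exports.

Local Open Scope classical_set_scope.
Local Open Scope ring_scope.

(** Write S for the sublevel set of f.  By definition a limiting normal g to S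
at xbar is a limit of functionals h_n that are almost Frechet normal to S at
points x_n -> xbar of S.  The proof transfers each h_n to the epigraph of f, at
the price of an extra vertical component - l_n with l_n in a fixed interval
[0, tau], and then passes to the limit.

Transfer.  Almost normality says that h_n (z - x_n) is at most
eps * |z - x_n| for z in S near x_n.  Since h_n is L-Lipschitz, for every z near
x_n it is at most eps * |z - x_n| + (L + eps) * d(z, S)
([eps_normals_penalization]), and the error bound replaces d(z, S) by a multiple
of the positive part r_+ of r for any (z, r) in the epigraph.  Thus (x_n, 0)
minimises, over the part of the epigraph above a neighbourhood of x_n,
  - h_n (z - x_n) + eps * |z - x_n| + M * r_+ ,
whose last term has a kink.  Replacing M * r_+ by the smooth function
(k / 2) * r_+ ^ 2 with k large gives a function that attains its minimum at a
point (y, f y) close to x_n in the first component, and Fermat's rule there says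
that (h_n, - l_n) is almost normal to the epigraph, with l_n = k * (f y)_+.
Comparing the two penalties at the minimiser bounds l_n by 2 * M, whatever k is
([fuzzy_epigraph_normal]).  Minimisers exist because f is lower semicontinuous
and closed balls of X are compact ([closed_ball_compact]).

Limit.  In finite dimension pointwise convergence of the h_n makes them
uniformly Lipschitz, with a constant depending only on X when g has norm at most
one; this is what makes M, and so tau, independent of g.  Continuity of f at
xbar carries (y_n, f (y_n)) to (xbar, f xbar), and a cluster point l of the l_n
yields a limiting normal (g, - l) to the epigraph with 0 <= l <= tau
([limiting_normals_epigraph]).  If l = 0 then g is a singular subgradient; if
l > 0 then, normal cones being cones, g / l is a subgradient.  So g always lies
in one of the two summands, the other one contributing 0. *)

(** * Compactness in finite-dimensional normed spaces *)

Section finite_dimension.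
Context {R : realType} {X : normedModType R}.
Implicit Types (e : nat -> X) (c : nat -> R).

Let comb e n c := \sum_(i < n) c i *: e i.

(** The box is built one coordinate at a time, adding a segment to a compact
set, so that coefficients can stay plain sequences. *)
Lemma compact_box_image e (r : R) n :
  compact [set x | exists2 c, (forall i, `|c i| <= r) & x = comb e n c].
Proof.
elim: n => [|n IHn].
  have [r0|r0] := leP 0 r.
    suff -> : [set x | exists2 c, (forall i, `|c i| <= r) & x = comb e 0 c]
              = [set 0] by exact: compact_set1.
    apply/seteqP; split => [x [c _ ->]|x ->] /=; first by rewrite /comb big_ord0.
    by exists (fun=> 0); [move=> i; rewrite normr0|rewrite /comb big_ord0].
  suff -> : [set x | exists2 c, (forall i, `|c i| <= r) & x = comb e 0 c]
            = set0 by exact: compact0.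
  rewrite -subset0 => x [c /(_ 0%N) cr _].
  by have := le_lt_trans cr r0; rewrite ltNge normr_ge0.
pose step (p : X * R) : X := p.1 + p.2 *: e n.
have step_cont : continuous step.
  move=> p; apply: cvgD; first exact: cvg_fst.
  by apply: cvgZr_tmp; exact: cvg_snd.
have := compact_setX IHn (@segment_compact R (- r) r).
move=> /(continuous_compact (continuous_subspaceT step_cont)).
congr compact; apply/seteqP; split => [x [[v t] [/= [c cr ->] tr] <-]|x [c cr ->]].
  exists (fun i => if i == n then t else c i) => [i|].
    by case: ifP => // _; move: tr; rewrite in_itv/= ler_norml.
  rewrite /comb big_ord_recr/= eqxx /step/=; congr (_ + _).
  by apply: eq_bigr => i _; rewrite ltn_eqF.
exists (comb e n c, c n); last by rewrite /step /comb big_ord_recr.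
by split => /=; [exists c|rewrite in_itv/= -ler_norml].
Qed.

(** Equivalence of norms in a form that needs no basis: the family may be
dependent, and coefficients are then chosen anew.  By induction on [n]: either
the last vector depends on the previous ones and is dropped, or it stays at a
distance [d > 0] from their span, and then [d] controls its coefficient. *)
Lemma bounded_coordinates e n :
  exists2 C : R, 0 <= C & forall c, exists2 c', comb e n c = comb e n c' &
    forall i, `|c' i| <= C * `|comb e n c|.
Proof.
elim: n => [|n [C C0 IHn]].
  exists 0 => // c; exists (fun=> 0); first by rewrite /comb !big_ord0.
  by move=> i; rewrite normr0 mul0r.
have [[a ea]|ndep] := pselect (exists a, e n = comb e n a).
  exists C => // c.
  have [c' c'E c'C] := IHn (fun i => c i + c n * a i).
  have cE : comb e n.+1 c = comb e n (fun i => c i + c n * a i).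
    rewrite /comb big_ord_recr/= ea /comb scaler_sumr -big_split/=.
    by apply: eq_bigr => i _; rewrite scalerDl scalerA.
  exists (fun i => if i == n then 0 else c' i) => [|i]; last first.
    by case: ifP => _; [rewrite normr0 mulr_ge0|rewrite cE].
  rewrite cE c'E /comb big_ord_recr/= eqxx scale0r addr0.
  by apply: eq_bigr => i _; rewrite ltn_eqF.
(* By induction, elements of the span that are close to [e n] have coefficients
   in a fixed box, whose image is compact, hence closed, and misses [e n]. *)
have [d [d0 dP]] : exists d : R, 0 < d /\ forall c, d <= `|e n - comb e n c|.
  pose r := C * (`|e n| + 1).
  have Bc := compact_closed (@norm_hausdorff _ X) (@compact_box_image e r n).
  have : ~ [set x | exists2 c, (forall i, `|c i| <= r) & x = comb e n c] (e n).
    by case=> c _ ec; apply: ndep; exists c.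
  move=> /(conj (closed_openC Bc))/open_nbhs_nbhs/nbhs_ballP[d /= d0 dB].
  exists (Num.min d 1); split; first by rewrite lt_min d0 ltr01.
  move=> c; rewrite leNgt; apply/negP; rewrite lt_min => /andP[cd c1].
  have [c' c'E c'C] := IHn c.
  apply: (dB (comb e n c)); first by rewrite -ball_normE.
  exists c' => // i; apply: le_trans (c'C i) _; apply: ler_wpM2l => //.
  rewrite -[comb e n c](subKr (e n)) (le_trans (ler_normB _ _))//.
  by rewrite lerD2l ltW.
exists (C * (1 + `|e n| / d) + d^-1).
  by rewrite addr_ge0 ?invr_ge0 ?(ltW d0)// mulr_ge0// addr_ge0// divr_ge0// ltW.
move=> c; set x := comb e n.+1 c.
have xE : x = comb e n c + c n *: e n by rewrite /x /comb big_ord_recr.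
have cnx : `|c n| <= d^-1 * `|x|.
  have [cn0|cn0] := eqVneq (c n) 0.
    by rewrite cn0 normr0 mulr_ge0// invr_ge0 ltW.
  rewrite mulrC ler_pdivlMr//.
  have -> : x = c n *: (e n - comb e n (fun i => - (c n)^-1 * c i)).
    rewrite xE scalerBr addrC; congr (_ + _).
    rewrite /comb scaler_sumr -sumrN; apply: eq_bigr => i _.
    by rewrite scalerA mulrA mulrN mulfV// mulN1r scaleNr opprK.
  by rewrite normrZ ler_wpM2l.
have vx : `|comb e n c| <= (1 + `|e n| / d) * `|x|.
  have -> : comb e n c = x - c n *: e n by rewrite xE addrK.
  rewrite (le_trans (ler_normB _ _))// mulrDl mul1r lerD2l normrZ.
  by rewrite -mulrA mulrC ler_wpM2l.
have [c' c'E c'C] := IHn c.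
exists (fun i => if i == n then c n else c' i) => [|i].
  rewrite xE c'E /comb big_ord_recr/= eqxx; congr (_ + _).
  by apply: eq_bigr => i _; rewrite ltn_eqF.
rewrite mulrDl; case: ifP => _.
  apply: le_trans cnx _; rewrite lerDr !mulr_ge0//.
  by rewrite addr_ge0// divr_ge0// ltW.
apply: le_trans (c'C i) _; rewrite -mulrA ler_wpDr ?ler_wpM2l//.
by rewrite mulr_ge0// invr_ge0 ltW.
Qed.

Hypothesis X_fin_dim : finite_dimensional X.

Lemma finite_dimensional_coordinates :
  exists n e, exists2 C : R, 0 <= C & forall x, exists2 c, x = comb e n c &
    forall i, `|c i| <= C * `|x|.
Proof.
have [n [b bP]] := X_fin_dim.
pose e i := oapp b 0 (insub i).
have [C C0 CP] := bounded_coordinates e n.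
exists n, e, C => // x; have [c ->] := bP x.
have -> : \sum_(i < n) c i *: b i = comb e n (fun i => oapp c 0 (insub i)).
  by apply: eq_bigr => i _; rewrite /e valK.
exact: CP.
Qed.

Lemma closed_ball_compact (a : X) (r : R) : compact [set x | `|x - a| <= r].
Proof.
have [n [e [C C0 CP]]] := finite_dimensional_coordinates.
apply: subclosed_compact (compact_box_image e (C * (`|a| + r)) n) _.
  have -> : [set x | `|x - a| <= r] = (fun x : X => `|x - a|) @^-1` [set y | y <= r].
    by [].
  apply: closed_comp (@closed_le _ r) => x _.
  by apply: cvg_norm; apply: cvgB; [exact: cvg_id|exact: cvg_cst].
move=> x /= xr; have [c xE cC] := CP x; exists c => // i.
apply: le_trans (cC i) _; rewrite ler_wpM2l// -[x in leLHS](subrK a) addrC.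
by rewrite (le_trans (ler_normD _ _))// lerD2l.
Qed.

End finite_dimension.

(** * Continuous functionals and normal cones *)

Section normals.
Set Implicit Arguments.
Unset Strict Implicit.
Context {R : realType} {X : normedModType R}.
Implicit Types (g h : X -> R) (A : set X) (a : X).

Lemma dualD g : dual g -> forall x y, g (x + y) = g x + g y.
Proof. by case=> gl _ x y; have := gl 1 x y; rewrite !scale1r. Qed.

Lemma dualZ g : dual g -> forall (t : R) x, g (t *: x) = t * g x.
Proof.
move=> gd t x; have [gl _] := gd.
have g0 : g 0 = 0 by have /eqP := dualD gd 0 0; rewrite addr0 -subr_eq subrr => /eqP.
by have := gl t x 0; rewrite !addr0 g0 addr0.
Qed.

Lemma dualB g : dual g -> forall x y, g (x - y) = g x - g y.
Proof. by move=> gd x y; rewrite dualD// -scaleN1r dualZ// mulN1r. Qed.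

Lemma dual0 g : dual g -> g 0 = 0.
Proof. by move=> gd; rewrite -(scale0r 0) dualZ// mul0r. Qed.

Lemma dual_scale g (t : R) : dual g -> dual (fun x => t * g x).
Proof.
move=> gd; split=> [s x y|].
  by rewrite dualD// dualZ// mulrDr mulrCA.
by move=> x; apply: cvgM; [exact: cvg_cst|exact: gd.2].
Qed.

(** The working form of the definition: the upper limit is unfolded into a local
linear inequality, which holds trivially at [a] itself, so the puncture of the
neighbourhood disappears. *)
Lemma eps_normalsP (eps : R) A a g : eps_normals eps A a g <->
  dual g /\ forall e, 0 < e ->
    \forall x \near a, A x -> g (x - a) <= (eps + e) * `|x - a|.
Proof.
split=> -[gd geps]; split=> //.
  move=> e e0.
  have : (ereal_inf [set ereal_sup ((fun x => (g (x - a) / `|x - a|)%:E) @` V) |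
      V in within A a^'] < (eps + e)%:E)%E.
    by apply: le_lt_trans geps _; rewrite lte_fin ltrDl.
  move=> /ereal_inf_lt[_ [V aV <-] Ve].
  have {}aV : \forall x \near a, x != a -> A x -> V x by [].
  near=> x => Ax.
  have [->|xa] := eqVneq x a; first by rewrite subrr normr0 mulr0 dual0.
  rewrite -ler_pdivrMr ?normr_gt0 ?subr_eq0// -lee_fin.
  apply: le_trans (ltW Ve); apply: ereal_sup_ubound; exists x => //.
  by move: xa Ax; near: x.
apply/lee_addgt0Pr => e e0.
pose V := [set x | g (x - a) / `|x - a| <= eps + e].
apply: (@le_trans _ _ (ereal_sup ((fun x => (g (x - a) / `|x - a|)%:E) @` V))).
  apply: ereal_inf_lbound; exists V => //.
  suff : \forall x \near a, x != a -> A x -> V x by [].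
  near=> x => xa Ax; rewrite /V/= ler_pdivrMr ?normr_gt0 ?subr_eq0//.
  by move: Ax; near: x; exact: geps.
by apply: ge_ereal_sup => _ [x Vx <-]; rewrite lee_fin.
Unshelve. all: by end_near. Qed.

Lemma eps_normals_le (eps eps' : R) A a : eps <= eps' ->
  eps_normals eps A a `<=` eps_normals eps' A a.
Proof.
by move=> ee g [gd gl]; split=> //; apply: le_trans gl _; rewrite lee_fin.
Qed.

Lemma eps_normals_scale (eps t : R) A a g : 0 < t ->
  eps_normals eps A a g -> eps_normals (t * eps) A a (fun x => t * g x).
Proof.
move=> t0 /eps_normalsP[gd gP]; apply/eps_normalsP; split; first exact: dual_scale.
move=> e e0; have /gP : 0 < e / t by rewrite divr_gt0.
apply: filterS => x gx /gx; rewrite -(ler_pM2l t0) mulrA.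
by rewrite mulrDr mulrCA mulfV ?gt_eqF// mulr1.
Qed.

Lemma limiting_normals_scale (t : R) A a g : 0 < t ->
  limiting_normals A a g -> limiting_normals A a (fun x => t * g x).
Proof.
move=> t0 [gd [eps [x [h [[eps0 epsd] epsc [Ax xa] hx hg]]]]].
split; first exact: dual_scale.
exists (fun n => t * eps n), x, (fun n v => t * h n v); split => //.
- split=> [n|m n mn]; first by rewrite mulr_ge0// ltW.
  by rewrite ler_pM2l// epsd.
- rewrite -[X in _ --> X](mulr0 t); apply: cvgM => //; exact: cvg_cst.
- by move=> n; exact: eps_normals_scale.
- by move=> v; apply: cvgM => //; exact: cvg_cst.
Qed.

Lemma limiting_normals0 A a : A a -> limiting_normals A a (cst 0).
Proof.
have d0 : @dual R X (cst 0).
  by split=> [t x y|]; [rewrite /cst/= scaler0 addr0|exact: cst_continuous].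
move=> Aa; split=> //.
exists (fun=> 0), (fun=> a), (fun _ _ => 0); split.
- by split.
- exact: cvg_cst.
- by split=> //; exact: cvg_cst.
- move=> n; apply/eps_normalsP; split=> // e e0; near=> x => _.
  by rewrite add0r mulr_ge0// ltW.
- by move=> v; exact: cvg_cst.
Unshelve. all: by end_near. Qed.

Lemma dual_dual_pair g (t : R) : dual g -> dual (dual_pair g t).
Proof.
move=> gd; split=> [s [x r] [y u]|].
  rewrite /dual_pair/= dualD// dualZ//= /GRing.scale/=; ring.
move=> p; apply: cvgD.
  by apply: continuous_comp; [exact: cvg_fst|exact: gd.2].
by apply: cvgM; [exact: cvg_cst|exact: cvg_snd].
Qed.

End normals.

(** * From normals to the sublevel set to normals to the epigraph *)

Section fuzzy.
Set Implicit Arguments.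
Unset Strict Implicit.
Context {R : realType} {X : normedModType R}.
Implicit Types (g h : X -> R) (A : set X) (a x y z : X).

(** Exact penalization.  A point of [S] almost nearest to [z] is still close to
[x], so that normality applies to it, and [h] being [L]-Lipschitz accounts for
the distance between [z] and this point. *)
Lemma eps_normals_penalization (S : set X) x h (L eps eps' : R) :
  0 <= L -> (forall v, `|h v| <= L * `|v|) -> 0 <= eps' -> eps < eps' ->
  eps_normals eps S x h ->
  \forall z \near x, forall D : R, (distance z S <= D%:E)%E ->
    h (z - x) <= eps' * `|z - x| + (L + eps') * D.
Proof.
move=> L0 hL e'0 ee' /eps_normalsP[hd hP].
have ee0 : 0 < eps' - eps by rewrite subr_gt0.
have /nbhs_ballP[rho /= rho0 rhoP] := hP _ ee0.
apply/nbhs_ballP; exists (rho / 2) => /=; first by rewrite divr_gt0.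
move=> z; rewrite -ball_normE/= distrC => zx D zD.
have hz v : h v <= L * `|v| by exact: le_trans (ler_norm _) (hL v).
(* When [D] is at least the distance to [x], the bound on [h] is enough. *)
have [xD|Dx] := leP `|z - x| D.
  apply: le_trans (hz _) _; rewrite mulrDl addrCA ler_wpDr ?ler_wpM2l//.
  by rewrite addr_ge0// mulr_ge0// (le_trans _ xD).
apply/ler_addgt0Pr => t t0.
(* The first bound on the slack [t'] absorbs its cost in [t]; the second one
   keeps the chosen point of [S] closer to [z] than [x] is. *)
pose t' := Num.min (t / (L + eps' + 1)) (`|z - x| - D).
have Le0 : 0 < L + eps' + 1 by rewrite ltr_wpDl// addr_ge0.
have t'0 : 0 < t' by rewrite lt_min divr_gt0//= subr_gt0.
have : (distance z S < (D + t')%:E)%E.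
  by apply: le_lt_trans zD _; rewrite lte_fin ltrDl.
move=> /ereal_inf_lt[_ [u Su <-]]; rewrite lte_fin => zu.
have zuzx : `|z - u| < `|z - x|.
  apply: lt_le_trans zu _; rewrite -lerBrDl /t'.
  by rewrite ge_min lexx orbT.
have ux : `|u - x| <= `|z - u| + `|z - x|.
  by rewrite -[u - x](subrKA z) (le_trans (ler_normD _ _))// (distrC u).
have hu : h (u - x) <= eps' * `|u - x|.
  have := rhoP u; rewrite -ball_normE/= distrC subrKC; apply => //.
  by apply: (le_lt_trans ux); rewrite [ltRHS](splitr rho) ltrD// (lt_trans zuzx).
have -> : z - x = (z - u) + (u - x) by rewrite subrKA.
rewrite dualD// subrKA.
have tt' : (L + eps') * t' <= t.
  apply: (@le_trans _ _ ((L + eps' + 1) * t')).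
    by rewrite ler_wpM2r ?ltW// ltrDl.
  by rewrite mulrC -ler_pdivlMr// /t' ge_min lexx.
have h1 := hz (z - u).
have h2 : eps' * `|u - x| <= eps' * (`|z - u| + `|z - x|) by rewrite ler_wpM2l.
have h3 : (L + eps') * `|z - u| <= (L + eps') * (D + t').
  by rewrite ler_wpM2l ?addr_ge0// ltW.
lra.
Qed.

Lemma closed_epigraph (f : X -> \bar R) :
  lower_semicontinuous f -> closed (epigraph f).
Proof.
move=> flsc; rewrite -[epigraph f]setCK; apply: open_closedC.
rewrite openE => -[x r]; rewrite /setC/= /epigraph/= => /negP; rewrite -ltNge => rf.
have [s rs sf] : exists2 s : R, r < s & (s%:E < f x)%E.
  move: rf; case: (f x) => [v|_|//].
    rewrite lte_fin => rv; exists ((r + v) / 2); rewrite ?lte_fin; lra.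
  by exists (r + 1); rewrite ?ltry//; lra.
have [V xV VP] := flsc x s sf.
rewrite /interior; exists (V, [set t | t < s]) => /=.
  by split=> //; exact: lt_nbhsl.
move=> [z t] [/= Vz ts]; apply/negP; rewrite -ltNge.
by apply: lt_trans (VP z Vz); rewrite lte_fin.
Qed.

(** The squared positive part exceeds its linearization at [r] by at most the
square of the increment: this is the only smoothness that Fermat's rule for
the penalty uses. *)
Lemma sqr_max0_le (r u : R) :
  (Num.max u 0) ^+ 2 <=
  (Num.max r 0) ^+ 2 + 2 * Num.max r 0 * (u - r) + (u - r) ^+ 2.
Proof.
have := sqr_ge0 (u - r); have := sqr_ge0 u; have := sqr_ge0 r; rewrite !expr2.
case: (lerP u 0) => u0; case: (lerP r 0) => r0; rewrite ?mulr0 ?mul0r ?add0r//.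
- by move=> *; lra.
- by move=> *; nra.
- by move=> *; nra.
Qed.

Hypothesis X_fin_dim : finite_dimensional X.

(** The last hypothesis says that [(x, 0)] minimises
[- h (z - x) + e |z - x| + M r_+] over the epigraph near [x].  The nonsmooth
[M r_+] is traded for [k / 2 r_+ ^+ 2], and [e] for [2 e] so that some growth is
left to keep the new minimiser near [x].  At the minimiser the new function is
at most 0 and the old one at least 0; the difference of the two inequalities
gives both [k r_+ <= 2 M] and the bound [2 M ^+ 2 / k] on [e |y - x|]. *)
Lemma fuzzy_epigraph_normal (f : X -> \bar R) x h (e M B eta : R) :
  lower_semicontinuous f -> dual h -> 0 < e -> 0 <= M -> 0 < eta ->
  (f x <= 0)%E -> (\forall z \near x, (`|f z| < B%:E)%E) ->
  (\forall z \near x, forall r : R, (f z <= r%:E)%E ->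
     h (z - x) <= e * `|z - x| + M * Num.max r 0) ->
  exists y (l : R), [/\ `|y - x| < eta, 0 <= l <= 2 * M, f y \is a fin_num &
    eps_normals (2 * e) (epigraph f) (y, fine (f y)) (dual_pair h (- l))].
Proof.
move=> flsc hd e0 M0 eta0 fx fB hest.
have [rho [rho0 rhoeta rhoP]] : exists rho : R, [/\ 0 < rho, rho < eta &
    forall z, `|z - x| <= rho -> (`|f z| < B%:E)%E /\
      forall r : R, (f z <= r%:E)%E ->
      h (z - x) <= e * `|z - x| + M * Num.max r 0].
  have /nbhs_ballP[d /= d0 dP] : \forall z \near x, (`|f z| < B%:E)%E /\
      forall r : R, (f z <= r%:E)%E ->
      h (z - x) <= e * `|z - x| + M * Num.max r 0 by exact: filterI.
  exists (Num.min d eta / 2); rewrite divr_gt0 ?lt_min ?d0//.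
  have m0 : 0 < Num.min d eta by rewrite lt_min d0.
  have mm : Num.min d eta / 2 < Num.min d eta by rewrite ltr_pdivrMr// ltr_pMr// ltr1n.
  have [md me] : Num.min d eta <= d /\ Num.min d eta <= eta by rewrite !ge_min !lexx orbT.
  split=> // [|z zx]; first exact: lt_le_trans me.
  apply: dP; rewrite -ball_normE/= distrC; apply: le_lt_trans zx _.
  exact: lt_le_trans md.
(* [k] is chosen to make [2 M ^+ 2 / k < e rho]: the minimiser then lies in the
   interior of the ball of radius [rho]. *)
pose k := 2 * M ^+ 2 / (e * rho) + 1.
have k0 : 0 < k by rewrite ltr_wpDl// divr_ge0// mulr_ge0// ?sqr_ge0// ltW.
have kE : k * (e * rho) = 2 * M ^+ 2 + e * rho.
  by rewrite /k mulrDl mul1r mulfVK// mulf_neq0// gt_eqF.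
pose Phi (p : X * R) := - h (p.1 - x) + 2 * e * `|p.1 - x| + k / 2 * (Num.max p.2 0) ^+ 2.
have Phi_cont : continuous Phi.
  have fstx (p : X * R) : (q.1 - x) @[q --> p] --> p.1 - x.
    by apply: cvgB; [exact: cvg_fst|exact: cvg_cst].
  move=> p; apply: cvgD; first apply: cvgD.
  - by apply: cvgN; apply: (cvg_comp _ _ (fstx p)); exact: hd.2.
  - by apply: cvgM; [exact: cvg_cst|apply: cvg_norm; exact: fstx].
  - apply: cvgM; first exact: cvg_cst.
    have mx : Num.max (q.2 : R) 0 @[q --> p] --> Num.max p.2 0.
      by apply: continuous_max; [exact: cvg_snd|exact: cvg_cst].
    by under eq_fun do rewrite expr2; rewrite expr2; apply: cvgM.
(* Truncating the epigraph at height [B] makes it compact; as [|f| < B] on the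
   ball, the truncation is invisible near the points of the graph. *)
pose K := ([set z | `|z - x| <= rho] `*` `[- B, B]%classic) `&` epigraph f.
have Kc : compact K.
  apply: compact_closedI; last exact: closed_epigraph.
  by apply: compact_setX; [exact: closed_ball_compact|exact: segment_compact].
have inK z (r : R) : K (z, r) <-> [/\ `|z - x| <= rho, `|r| <= B & (f z <= r%:E)%E].
  rewrite /K/= in_itv/= -ler_norml.
  by split=> [[[]]|[]].
have B0 : 0 < B.
  have [|fxB _] := rhoP x; first by rewrite subrr normr0 ltW.
  by rewrite -lte_fin; apply: le_lt_trans fxB; exact: abse_ge0.
have Kx : K (x, 0) by apply/inK; rewrite subrr !normr0; split=> //; exact: ltW.
have [[y r0] /[!inE] /inK[yx r0B fyr0] ymin] :=
  compact_EVT_min (ex_intro _ _ Kx) Kc (continuous_subspaceT Phi_cont).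
have [fyB yest] := rhoP y yx.
have fyfin : f y \is a fin_num by rewrite fin_num_abs (lt_le_trans fyB)// leey.
(* Lowering [r0] to [f y] does not increase [Phi], which is nondecreasing in its
   second argument, so the minimum is also attained on the graph. *)
set r := fine (f y).
have fyE : f y = r%:E by rewrite fineK.
have rB : `|r| < B by rewrite -lte_fin -abse_EFin -fyE.
have rmin z (u : R) : K (z, u) -> Phi (y, r) <= Phi (z, u).
  move=> Kz; apply: (@le_trans _ _ (Phi (y, r0))); last by apply: ymin; rewrite inE.
  rewrite /Phi/= lerD2l; apply: ler_wpM2l; first by rewrite divr_ge0// ltW.
  have mx0 (t : R) : 0 <= Num.max t 0 by rewrite le_max lexx orbT.
  apply: lerXn2r; rewrite ?nnegrE//.
  by rewrite ge_max mx0 andbT le_max -lee_fin -fyE fyr0.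
have := rmin _ _ Kx; rewrite /Phi/= subrr normr0 (dual0 hd) maxxx => Phi_le.
have {}yest : h (y - x) <= e * `|y - x| + M * Num.max r 0.
  by apply: yest; rewrite fyE.
move: Phi_le yest; set s := Num.max r 0; set N := `|y - x|.
have s0 : 0 <= s by rewrite le_max lexx orbT.
have N0 : 0 <= N by rewrite normr_ge0.
move=> Phi_le yest.
have sle : e * N + k / 2 * s ^+ 2 <= M * s by lra.
have ks : k * s <= 2 * M.
  have [->|sn0] := eqVneq s 0; first by rewrite mulr0 mulr_ge0.
  have sp : 0 < s by rewrite lt_neqAle eq_sym sn0.
  rewrite -(ler_pM2r sp); nra.
have Nrho : N < rho.
  rewrite -(ltr_pM2l e0) -(ltr_pM2l k0).
  apply: (@le_lt_trans _ _ (2 * M ^+ 2)); last by rewrite kE; nra.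
  nra.
exists y, (k * s); split => //.
- exact: lt_trans rhoeta.
- by rewrite ks mulr_ge0// ltW.
apply/eps_normalsP; split; first exact: dual_dual_pair.
move=> e1 e10; rewrite -/r.
have near1 : \forall z \near y, `|z - x| < rho.
  have : `|z - x| @[z --> y] --> N.
    by apply: cvg_norm; apply: cvgB; [exact: cvg_id|exact: cvg_cst].
  by move=> /cvgr_lt; apply.
have near2 : \forall u \near r, `|u| < B.
  have : `|u| @[u --> r] --> `|r| by apply: cvg_norm; exact: cvg_id.
  by move=> /cvgr_lt; apply.
have near3 : \forall u \near r, `|u - r| <= 2 * e1 / k.
  have : `|u - r| @[u --> r] --> `|r - r|.
    by apply: cvg_norm; apply: cvgB; [exact: cvg_id|exact: cvg_cst].
  move=> /cvgr_le; apply; rewrite subrr normr0; rewrite divr_gt0// mulr_gt0//.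
have : \forall p \near (y, r), `|p.1 - x| < rho /\ (`|p.2| < B /\ `|p.2 - r| <= 2 * e1 / k).
  exists ([set z | `|z - x| < rho], [set u | `|u| < B /\ `|u - r| <= 2 * e1 / k]).
    by split=> //; exact: filterI.
  by move=> [z u] [].
apply: filterS => -[z u] [/= zx [uB ur]] fzu.
have := rmin z u; rewrite inK => /(_ (And3 (ltW zx) (ltW uB) fzu)).
rewrite /Phi/= -/s -/N => Phi_zu.
have := sqr_max0_le r u; rewrite -/s => sq.
rewrite prod_normE/=; set P := Num.max _ _.
have P1 : `|z - y| <= P by rewrite le_max lexx.
have P2 : `|u - r| <= P by rewrite le_max lexx orbT.
have hzy : h (z - y) = h (z - x) - h (y - x) by rewrite -dualB// opprB subrKA.
have nzy : `|z - x| <= `|z - y| + N.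
  by rewrite -[z - x](subrKA y) ler_normD.
rewrite /dual_pair/= hzy.
have sqP : k / 2 * (u - r) ^+ 2 <= e1 * P.
  rewrite -(real_normK (num_real _)) expr2 mulrA; apply: ler_pM => //.
    by rewrite mulr_ge0// divr_ge0// ltW.
  by move: ur; rewrite ler_pdivlMr//; lra.
have := ler_wpM2l (ltW k0) sq.
have := ler_wpM2l (ltW e0) nzy; have := ler_wpM2l (ltW e0) P1.
lra.
Qed.

End fuzzy.

(** * Passage to the limit *)

Section limit.
Set Implicit Arguments.
Unset Strict Implicit.
Context {R : realType} {X : normedModType R}.
Implicit Types (g : X -> R) (x y z : X).

Lemma dual_unit_ball_le g x : dual_unit_ball g -> `|g x| <= `|x|.
Proof.
move=> [gd g1]; have [->|x0] := eqVneq x 0; first by rewrite (dual0 gd) !normr0.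
have nx0 : 0 < `|x| by rewrite normr_gt0.
have : `|g (`|x|^-1 *: x)| <= 1.
  rewrite -lee_fin; apply: le_trans g1; apply: ereal_sup_ubound.
  exists (`|x|^-1 *: x) => //=.
  by rewrite normrZ normfV normr_id mulVf// gt_eqF.
by rewrite dualZ// normrM normfV normr_id mulrC ler_pdivrMr// mul1r.
Qed.

(** The values at finitely many vectors control the norm of a functional, so a
pointwise convergent sequence of functionals is uniformly Lipschitz. *)
Lemma dual_finite_dim_bound : finite_dimensional X ->
  exists n (e : nat -> X), exists2 C : R, 0 <= C & forall g, dual g ->
    forall x, `|g x| <= C * (\sum_(i < n) `|g (e i)|) * `|x|.
Proof.
move=> /finite_dimensional_coordinates[n [e [C C0 CP]]].
exists n, e, C => // g gd x; have [c xE cC] := CP x.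
have -> : g x = \sum_(i < n) c i * g (e i).
  rewrite {1}xE; elim/big_ind2 : _ => //; first exact: dual0.
    by move=> u a v b <- <-; rewrite dualD.
  by move=> i _; rewrite dualZ.
rewrite (le_trans (ler_norm_sum _ _ _))// mulrAC mulr_sumr ler_sum// => i _.
by rewrite normrM ler_wpM2r.
Qed.

Lemma cvg_infty_of_ge (m : nat -> nat) : (forall j, (j <= m j)%N) ->
  m j @[j --> \oo] --> \oo.
Proof.
move=> jm A [N _ NA]; exists N => // j /= Nj; apply: NA => /=.
exact: leq_trans (jm j).
Qed.

(** A substitute for extracting a convergent subsequence: the indices tend to
infinity and need not increase, which suffices for taking limits. *)
Lemma cluster_selection (u : R^nat) (a b : R) (P : nat -> Prop) :
  (\forall n \near \oo, P n) -> (forall n, P n -> a <= u n <= b) ->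
  exists2 l, a <= l <= b & exists m : nat -> nat,
    [/\ forall j, (j <= m j)%N, forall j, P (m j) & u (m j) @[j --> \oo] --> l].
Proof.
move=> nP Pu.
have [l [lab lclu]] : `[a, b]%classic `&` cluster (u n @[n --> \oo]) !=set0.
  apply: segment_compact; apply: filterS nP => n /Pu.
  by rewrite /= in_itv.
have sel j : exists m, [/\ (j <= m)%N, P m & `|l - u m| < j.+1%:R^-1].
  have : (u n @[n --> \oo]) [set u n | n in [set n | (j <= n)%N /\ P n]].
    have : \forall n \near \oo, (j <= n)%N /\ P n.
      by apply: filterI => //; exists j.
    by apply: filterS => n nj; exists n.
  have : nbhs l (ball l (j.+1%:R^-1)) by apply: nbhsx_ballx; rewrite invr_gt0.
  move=> /[swap] /lclu/[apply] -[_ [[n [jn Pn] <-]]].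
  by rewrite -ball_normE => lun; exists n.
have [m mP] := choice sel.
exists l; first by move: lab; rewrite /= in_itv.
exists m; split=> [j|j|]; [by have [] := mP j|by have [] := mP j|].
apply/cvgrPdist_lt => t t0; have := near_infty_natSinv_lt (PosNum t0).
by apply: filterS => j; apply: lt_trans; have [] := mP j.
Qed.

(** The multiplier [l] stays bounded uniformly in [g] because the Lipschitz
constant [L] below depends only on the space once [g] is in the unit ball. *)
Lemma limiting_normals_epigraph (f : X -> \bar R) x0 :
  finite_dimensional X -> lower_semicontinuous f -> f x0 \is a fin_num ->
  local_error_bound f x0 -> {for x0, continuous f} ->
  exists2 tau : R, 0 < tau & forall g,
    limiting_normals (sublevel0 f) x0 g -> dual_unit_ball g ->
    exists2 l, 0 <= l <= tau &
      limiting_normals (epigraph f) (x0, fine (f x0)) (dual_pair g (- l)).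
Proof.
move=> Xfin flsc fx0 [tau0 [delta [tau00 delta0 feb]]] fcont.
have [n [e [C C0 CP]]] := dual_finite_dim_bound Xfin.
pose L := C * (\sum_(i < n) `|e i| + 1).
have L0 : 0 <= L by rewrite mulr_ge0// addr_ge0// sumr_ge0.
pose M := (L + 1) * tau0.
have M0 : 0 < M by rewrite mulr_gt0// ltr_wpDl.
have fcv : fine (f z) @[z --> x0] --> fine (f x0) /\ \forall z \near x0, f z \is a fin_num.
  have : f z @[z --> x0] --> (fine (f x0))%:E by rewrite fineK.
  by move=> /fine_cvgP[].
pose B := `|fine (f x0)| + 1.
have fB : \forall x \near x0, \forall z \near x, (`|f z| < B%:E)%E.
  suff : \forall z \near x0, (`|f z| < B%:E)%E by move=> /nbhs_interior.
  have nB : \forall z \near x0, `|fine (f z)| < B.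
    have /cvgr_lt : `|fine (f z)| @[z --> x0] --> `|fine (f x0)|.
      by apply: cvg_norm; exact: fcv.1.
    by apply; rewrite ltrDl.
  apply: filterS2 nB fcv.2 => z zB zfin.
  by rewrite -(fineK zfin) abse_EFin lte_fin.
have dB : \forall x \near x0, \forall z \near x, ball x0 delta z.
  by apply: nbhs_interior; exact: nbhsx_ballx.
exists (2 * M); first by rewrite mulr_gt0.
move=> g [gd [eps [x [h [[eps0 epsd] epsc [Sx xx0] hx hg]]]]] g1.
have hd m : dual (h m) by have [] := hx m.
(* Almost normality with constant [eps m] only gives local inequalities with a
   larger, positive constant; adding a vanishing term provides one. *)
pose e' m := eps m + harmonic m.
have e'0 m : 0 < e' m by rewrite ltr_wpDl// invr_gt0.
have e'c : e' m @[m --> \oo] --> 0.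
  by rewrite -(addr0 0); apply: cvgD => //; exact: cvg_harmonic.
have hL : \forall m \near \oo, forall v, `|h m v| <= L * `|v|.
  have : \sum_(i < n) `|h m (e i)| @[m --> \oo] --> \sum_(i < n) `|g (e i)|.
    apply: cvg_big => [|i _]; first exact: add_continuous.
    by apply: cvg_norm; exact: hg.
  move=> /cvgr_lt/(_ (\sum_(i < n) `|e i| + 1)) => /(_ _)/filterS; apply.
    move=> m sm v; apply: le_trans (CP _ (hd m) v) _.
    by rewrite ler_wpM2r// ler_wpM2l// ltW.
  rewrite (@le_lt_trans _ _ (\sum_(i < n) `|e i|)) ?ltrDl//.
  by apply: ler_sum => i _; exact: dual_unit_ball_le.
pose good m (p : X * R) := [/\ `|p.1 - x m| < harmonic m, 0 <= p.2 <= 2 * M,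
  f p.1 \is a fin_num & eps_normals (2 * e' m) (epigraph f)
    (p.1, fine (f p.1)) (dual_pair (h m) (- p.2))].
have good_ex : \forall m \near \oo, exists p, good m p.
  have e'1 : \forall m \near \oo, e' m <= 1 by move: e'c => /cvgr_le; apply.
  near=> m.
  have ebm : \forall z \near x m, forall r : R, (f z <= r%:E)%E ->
      h m (z - x m) <= e' m * `|z - x m| + M * Num.max r 0.
    have hLm : forall v, `|h m v| <= L * `|v| by near: m.
    have lte' : eps m < e' m by rewrite ltrDl invr_gt0.
    have dBm : \forall z \near x m, ball x0 delta z by near: m; exact: xx0 dB.
    have := eps_normals_penalization L0 hLm (ltW (e'0 m)) lte' (hx m).
    apply: filterS2 dBm => z zd + r fzr.
    move=> /(_ (tau0 * Num.max r 0)) zpen.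
    have {}zpen := zpen _; apply: le_trans (zpen _) _.
      apply: le_trans (feb z zd) _; rewrite EFinM lee_wpmul2l ?lee_fin ?(ltW tau00)//.
      by rewrite EFin_max ge_max !le_max fzr lexx orbT.
    rewrite lerD2l mulrA ler_wpM2r ?le_max ?lexx ?orbT//.
    by rewrite /M ler_wpM2r ?(ltW tau00)// lerD2l; near: m.
  have fBm : \forall z \near x m, (`|f z| < B%:E)%E by near: m; exact: xx0 fB.
  have harm0 : 0 < harmonic m :> R by rewrite invr_gt0.
  have [y [l [yx lM fy yn]]] :=
    fuzzy_epigraph_normal Xfin flsc (hd m) (e'0 m) (ltW M0) harm0 (Sx m) fBm ebm.
  by exists (y, l).
have [p pP] : exists p : nat -> X * R, \forall m \near \oo, good m (p m).
  have /choice[p pP] : forall m, exists p, (exists q, good m q) -> good m p.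
    move=> m; have [[q gq]|nq] := pselect (exists q, good m q); first by exists q.
    by exists (0, 0) => /nq.
  by exists p; apply: filterS good_ex.
have [m Pm|l l0M [m [jm mgood lm]]] :=
  @cluster_selection (fun m => (p m).2) 0 (2 * M) (fun m => good m (p m)) pP.
  by case: Pm.
have mcv := cvg_infty_of_ge jm.
exists l => //; split; first exact: dual_dual_pair.
pose y j := (p (m j)).1.
have ycv : y j @[j --> \oo] --> x0.
  have yx : (y j - x (m j)) @[j --> \oo] --> (0 : X).
    apply/cvgrPdist_lt => t t0.
    have : \forall j \near \oo, (m j).+1%:R^-1 < t.
      exact: mcv _ (near_infty_natSinv_lt (PosNum t0)).
    apply: filterS => j /=; rewrite sub0r normrN.
    by apply: lt_trans; have [] := mgood j.
  have -> : y = (fun j => (y j - x (m j)) + x (m j)).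
    by apply/funext => j; rewrite subrK.
  by rewrite -[x0]add0r; apply: cvgD => //; exact: (cvg_comp _ _ mcv xx0).
(* The normality constants are indexed by [j], not [m j], to be nonincreasing;
   they are large enough as [j <= m j]. *)
exists (fun j => 2 * e' j), (fun j => (y j, fine (f (y j)))),
  (fun j => dual_pair (h (m j)) (- (p (m j)).2)).
have e'd : nonincreasing_seq e'.
  move=> i j ij; rewrite lerD ?epsd//= lef_pV2 ?posrE// ler_nat.
  by rewrite ltnS.
split.
- split=> [j|i j ij]; first by rewrite mulr_ge0// ltW.
  by rewrite ler_pM2l// e'd.
- by rewrite -(mulr0 2); apply: cvgM => //; exact: cvg_cst.
- split=> [j|].
    by rewrite /epigraph/= fineK//; have [] := mgood j.
  exact: (cvg_pair ycv (cvg_comp _ _ ycv fcv.1)).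
- move=> j; have [_ _ _] := mgood j.
  by apply: eps_normals_le; rewrite ler_pM2l// e'd.
- move=> v; rewrite /dual_pair; apply: cvgD.
    exact: (cvg_comp _ _ mcv (hg v.1)).
  by apply: cvgM; [exact: cvgN|exact: cvg_cst].
Unshelve. all: by end_near. Qed.

End limit.

Theorem theorem3p3 (R : realType) (X : normedModType R)
    (X_fin_dim : finite_dimensional X)
    (f : X -> \bar R)
    (f_gt_ninfty : forall x, f x <> -oo%E)
    (f_proper : exists x, (f x < +oo)%E)
    (f_lsc : lower_semicontinuous f)
    (xbar : X) (xbar_S : sublevel0 f xbar)
    (f_error_bound : local_error_bound f xbar)
    (f_cont : {for xbar, continuous f}) :
  exists2 tau : R, 0 < tau &
    limiting_normals (sublevel0 f) xbar `&` @dual_unit_ball R X `<=`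
      minkowski_sum (scaled_upto tau (subdifferential f xbar))
                    (singular_subdifferential f xbar).
Proof.
have fx_fin : f xbar \is a fin_num.
  rewrite fin_numE; apply/andP; split; first by apply/eqP; exact: f_gt_ninfty.
  by apply/eqP => fx; move: xbar_S; rewrite /sublevel0/= fx.
have [tau tau0 tauP] :=
  limiting_normals_epigraph X_fin_dim f_lsc fx_fin f_error_bound f_cont.
exists tau => // g [gN g1]; have [l l0tau lN] := tauP g gN g1.
have gd : dual g by have [] := g1.
have [l0|l0] := eqVneq l 0.
  exists (cst 0), g; split; first by left.
    by split=> //; move: lN; rewrite l0 oppr0.
  by apply/funext => x /=; rewrite add0r.
have lgt0 : 0 < l by rewrite lt_neqAle eq_sym l0; case/andP: l0tau.
exists g, (cst 0); split; last by apply/funext => x /=; rewrite addr0.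
  right; exists l, (fun x => l^-1 * g x); split=> //; last first.
    by apply/funext => x; rewrite mulrA mulfV// mul1r.
  split; first exact: dual_scale.
  have -> : dual_pair (fun x => l^-1 * g x) (-1) =
            (fun p => l^-1 * dual_pair g (- l) p).
    apply/funext => p; rewrite /dual_pair mulrDr !mulrA; congr (_ + _ * _).
    by rewrite mulrN mulVf.
  by apply: limiting_normals_scale => //; rewrite invr_gt0.
have epi0 : epigraph f (xbar, fine (f xbar)) by rewrite /epigraph/= fineK.
split; first by have [] := limiting_normals0 xbar_S.
have -> : dual_pair (cst 0 : X -> R) 0 = cst 0.
  by apply/funext => p; rewrite /dual_pair/= mul0r addr0.
exact: limiting_normals0.
Qed.
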